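(* Let $G=(V,E)$ with terminal set $R$ be a quasi-bipartite Steiner tree instance, let $c\in\mathbb{R}_{\ge 0}^A$ be non-negative (not necessarily symmetric) arc costs on the bidirected digraph $D=(V,A)$, and let $f$ be an intersecting supermodular function on subsets of $R$. Then the optimal values of $(\mathrm{BCR}_f)$ and $(\mathrm{DCR}_f)$ coincide.
   Context: $R\subseteq V$ are terminals, $V\setminus R$ Steiner vertices; quasi-bipartite means no edge of $G$ joins two Steiner vertices. $D=(V,A)$ has arcs $(u,v),(v,u)$ for each edge $uv\in E$. Fix a root $r\in R$; $U\subseteq V$ is valid if $U\cap R\neq\emptyset$ and $r\notin U$; $\delta^+(U)$ is the set of arcs with tail in $U$ and head outside $U$. A full component is a tree in $G$ whose leaves are terminals and whose internal vertices are Steiner vertices; orienting all its edges towards one of its terminals (the sink) gives a directed full component, whose other terminals are its sources. $\mathcal{K}$ is the set of directed full components, $c_K=\sum_{a\in K}c_a$. For $U\subseteq R$, $\Delta^+(U)$ is the set of $K\in\mathcal{K}$ whose sink is not in $U$ and which have a source in $U$. For a vector $x$ and index set $S$, $x(S)=\sum_{j\in S}x_j$. $f$ is intersecting supermodular if $f(A')+f(B')\le f(A'\cap B')+f(A'\cup B')$ whenever $A'\cap B'\neq\emptyset$. $(\mathrm{DCR}_f)$: $\min\sum_{K}c_Ky_K$ s.t. $y(\Delta^+(U))\ge f(U)$ for all nonempty $U\subseteq R\setminus\{r\}$, $y\ge0$. $(\mathrm{BCR}_f)$: $\min \sum_{a\in A}c_ax_a$ s.t. $x(\delta^+(U))\ge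 f(U\cap R)$ for all valid $U\subseteq V$, $x\ge 0$. *)

(* Defs.v *)
(* MathComp / MathComp-Analysis. *)
From mathcomp Require Import all_boot all_order all_algebra.
From mathcomp Require Import all_classical all_reals ereal.

Set Implicit Arguments.
Unset Strict Implicit.
Unset Printing Implicit Defensive.

Import Order.TTheory GRing.Theory Num.Theory.
Local Open Scope ring_scope.

(* A finite simple graph on V is given by its edge set E : {set {set V}}, all of
   whose members are two-element sets; a subgraph by a vertex set W : {set V}
   and an edge set F : {set {set V}}. *)
Section Graphs.
Variable V : finType.
Implicit Types (E F : {set {set V}}) (W R : {set V}).

Definition simple_graph E : Prop := forall e, e \in E -> #|e| = 2%N.

Definition adj F : rel V := fun u v => [set u; v]%SET \in F.

Definition degree F (v : V) : nat := #|[set e in F | v \in e]%SET|.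

Definition quasi_bipartite E R : Prop :=
  forall u v, adj E u v -> u \in R \/ v \in R.

Definition arcs E : {set V * V} := [set a : V * V | adj E a.1 a.2]%SET.

(* Traversing one edge back and forth is a [ucycle] with two vertices, hence
   the bound. *)
Definition acyclic F : Prop := forall p : seq V, ucycle (adj F) p -> (size p <= 2)%N.

Definition tree_in E W F : Prop :=
  [/\ W != finset.set0,
      F \subset E,
      forall e, e \in F -> e \subset W,
      {in W &, forall u v, connect (adj F) u v}
    & acyclic F].

(* A leaf is a vertex of degree one, every other vertex is internal; so the
   one-vertex tree at a terminal is not a full component. *)
Definition full_component E R W F : Prop :=
  [/\ tree_in E W F,
      {in W, forall v, degree F v = 1%N -> v \in R}
    & {in W, forall v, degree F v <> 1%N -> v \notin R}].

(* (u, v) is an arc iff the simple path from u to t along edges of F starts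
   with the edge {u, v}. *)
Definition orient F (t : V) : {set V * V} :=
  [set a : V * V | `[< exists p : seq V,
     [/\ path (adj F) a.1 (a.2 :: p), uniq (a.1 :: a.2 :: p)
       & last a.2 p = t] >]]%SET.

(* ((W, F), t): the tree (W, F) with all its edges oriented towards t. *)
Definition rooted_subgraph : finType := (({set V} * {set {set V}}) * V)%type.

Definition dverts (K : rooted_subgraph) : {set V} := K.1.1.
Definition dedges (K : rooted_subgraph) : {set {set V}} := K.1.2.
Definition sink (K : rooted_subgraph) : V := K.2.
Definition darcs (K : rooted_subgraph) : {set V * V} := orient (dedges K) (sink K).
Definition sources R (K : rooted_subgraph) : {set V} :=
  ((dverts K :&: R) :\ sink K)%SET.

Definition dir_full_components E R : {set rooted_subgraph} :=
  [set K | `[< [/\ full_component E R (dverts K) (dedges K),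
                   sink K \in dverts K & sink K \in R] >]]%SET.

Definition valid R (r : V) (U : {set V}) : bool :=
  (U :&: R != finset.set0)%SET && (r \notin U).

Definition delta_plus E (U : {set V}) : {set V * V} :=
  [set a in arcs E | (a.1 \in U) && (a.2 \notin U)]%SET.

Definition Delta_plus E R (U : {set V}) : {set rooted_subgraph} :=
  [set K in dir_full_components E R |
     (sink K \notin U) && [exists s in sources R K, s \in U]]%SET.

End Graphs.

(* Only the values of x (resp. y) on arcs (resp. on directed full components)
   matter. Optimal values are extended reals, +oo for an infeasible program. *)
Section LinearPrograms.
Variables (RR : realType) (V : finType).
Variables (E : {set {set V}}) (R : {set V}) (r : V).
Variables (c : V * V -> RR) (f : {set V} -> RR).

Definition intersecting_supermodular : Prop :=
  forall A B : {set V}, A \subset R -> B \subset R -> (A :&: B != finset.set0)%SET ->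
    f A + f B <= f (A :&: B)%SET + f (A :|: B)%SET.

Definition BCR_feasible (x : V * V -> RR) : Prop :=
  (forall a, a \in arcs E -> 0 <= x a) /\
  (forall U : {set V}, valid R r U ->
     f (U :&: R)%SET <= \sum_(a in delta_plus E U) x a).

Definition BCR_cost (x : V * V -> RR) : RR := \sum_(a in arcs E) c a * x a.

Definition BCR_opt : \bar RR :=
  ereal_inf [set (BCR_cost x)%:E | x in BCR_feasible]%classic.

Definition comp_cost (K : rooted_subgraph V) : RR := \sum_(a in darcs K) c a.

Definition DCR_feasible (y : rooted_subgraph V -> RR) : Prop :=
  (forall K, K \in dir_full_components E R -> 0 <= y K) /\
  (forall U : {set V}, U != finset.set0 -> U \subset (R :\ r)%SET ->
     f U <= \sum_(K in Delta_plus E R U) y K).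

Definition DCR_cost (y : rooted_subgraph V -> RR) : RR :=
  \sum_(K in dir_full_components E R) comp_cost K * y K.

Definition DCR_opt : \bar RR :=
  ereal_inf [set (DCR_cost y)%:E | y in DCR_feasible]%classic.

End LinearPrograms.

(* Main.v *)
(* One inequality is a projection: x_a = sum of y_K over the components K using a.

   For the other, let x be feasible for (BCR_f). If no feasible y costs at most
   c x, Farkas' lemma gives l >= 0 and weights z >= 0 on the sets U such that
   the z-weight of {U | K in Delta^+(U)} is at most l c_K for all K, but
   sum_U f(U) z_U > l c x. Uncrossing makes z laminar. For each Steiner vertex v,
   split z_U = e_U + (z_U - e_U), the second part belonging to U + v: charging e
   greedily from small to large sets keeps the load of {U | s in U} under e below
   l c_(s,v) and that of {U | t not in U} under z - e below l c_(v,t), because by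
   laminarity a violation would exhibit a star centred at v whose packing
   constraint fails. For a fixed U, the cheaper choice of side for every Steiner
   vertex gives a valid set U' with U' & R = U, so f(U) z_U is at most the
   corresponding split combination of x; summing over U gives
   sum_U f(U) z_U <= l c x, a contradiction. *)
Require Import Defs.
From mathcomp Require Import all_boot all_order all_algebra.
From mathcomp Require Import all_classical all_reals ereal.
From mathcomp Require Import ring lra zify.

Import Order.TTheory GRing.Theory Num.Theory.
Local Open Scope ring_scope.

(** * Linear programming *)

(** This supplies the value of the variable that Fourier-Motzkin elimination removes: the largest
    lower bound, or the smallest upper bound when there is no lower one, or 0 when there is
    neither. *)
Lemma finite_separation {R : realFieldType} {I : finType} (P Q : pred I)
    (l u : I -> R) :
    (forall i k, P i -> Q k -> l i <= u k) ->
  exists t, (forall i, P i -> l i <= t) /\ (forall k, Q k -> t <= u k).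
Proof.
move=> lu; case: (pickP P) => [i0 Pi0|P0].
  case: (arg_maxP l Pi0) => i Pi li; exists (l i).
  by split=> [j Pj|k Qk]; [exact: li|exact: lu].
case: (pickP Q) => [k0 Qk0|Q0].
  case: (arg_minP u Qk0) => k Qk uk; exists (u k).
  by split=> [j|j Qj]; [rewrite P0|exact: uk].
by exists 0; split=> j; rewrite ?P0 ?Q0.
Qed.

(* Fourier-Motzkin elimination of the first variable: the constraint indexed by
   (i, k) is the combination of constraints i and k with weights m1, m2. *)
Lemma farkas_ord {R : realFieldType} n (I : finType) (A : I -> 'I_n -> R)
    (b : I -> R) :
  (exists z : 'I_n -> R, forall i, \sum_j A i j * z j <= b i) \/
  (exists y : I -> R, [/\ forall i, 0 <= y i,
     forall j, \sum_i y i * A i j = 0 & \sum_i y i * b i < 0]).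
Proof.
elim: n I A b => [|n IH] I A b.
  case: (pickP (fun i => b i < 0)) => [i bi|b_ge0].
    right; exists (fun k => (k == i)%:R); split=> [k|[]//|].
      by rewrite ler0n.
    rewrite (bigD1 i) //= eqxx mul1r big1 ?addr0 // => k /negPf ->.
    by rewrite mul0r.
  left; exists (fun=> 0) => i.
  by rewrite big_ord0 leNgt b_ge0.
pose a i := A i ord0.
pose pn i k := (0 < a i) && (a k < 0).
(* If the eliminated variable has coefficient positive in row [i] and negative in row [k], the
   weights cancel it. Any other pair yields row [i] itself when its coefficient is 0, and the
   trivial constraint 0 <= 0 otherwise. *)
pose m1 i k := if pn i k then - a k else (a i == 0)%:R.
pose m2 i k := if pn i k then a i else 0.
have m1_ge0 i k : 0 <= m1 i k.
  by rewrite /m1; case: ifP => [/andP[_ /ltW]|_]; rewrite ?oppr_ge0 ?ler0n.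
have m2_ge0 i k : 0 <= m2 i k by rewrite /m2; case: ifP => [/andP[/ltW]|].
have m_a i k : m1 i k * a i + m2 i k * a k = 0.
  rewrite /m1 /m2; case: ifP => _; first by ring.
  by case: eqP => [->|_]; rewrite !(mulr0, mul0r) addr0.
pose A' (ik : I * I) (j : 'I_n) :=
  m1 ik.1 ik.2 * A ik.1 (lift ord0 j) + m2 ik.1 ik.2 * A ik.2 (lift ord0 j).
pose b' (ik : I * I) := m1 ik.1 ik.2 * b ik.1 + m2 ik.1 ik.2 * b ik.2.
case: (IH _ A' b') => [[z zb]|[y [y_ge0 yA yb]]].
  pose r i := \sum_j A i (lift ord0 j) * z j.
  have zr i k : m1 i k * r i + m2 i k * r k <= m1 i k * b i + m2 i k * b k.
    have := zb (i, k); rewrite /b' /=; congr (_ <= _).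
    rewrite /r !mulr_sumr -big_split; apply: eq_bigr => j _ /=.
    by rewrite /A' /=; ring.
  pose bnd i := (b i - r i) / a i.
  have bnd_le k i : a k < 0 -> 0 < a i -> bnd k <= bnd i.
    move=> ak ai; move: (zr i k); rewrite /m1 /m2 /pn ak ai /=.
    by rewrite /bnd ler_ndivrMr // mulrAC ler_pdivrMr //; nra.
  have [t [tl tu]] := finite_separation (fun i => a i < 0) (fun i => 0 < a i)
    bnd bnd bnd_le.
  left; exists (fun j => if unlift ord0 j is Some j' then z j' else t) => i.
  rewrite big_ord_recl unlift_none.
  under eq_bigr => j _ do rewrite liftK.
  rewrite -/(r i) -/(a i).
  case: (ltgtP (a i) 0) => [ai|ai|ai].
  - by have := tl i ai; rewrite /bnd ler_ndivrMr //; lra.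
  - by have := tu i ai; rewrite /bnd ler_pdivlMr //; lra.
  - by have := zr i i; rewrite /m1 /m2 /pn ai ltxx eqxx /=; lra.
(* The multiplier of row [i] collects those of all combined rows in which [i] occurs, as first or as
   second member. *)
right; exists (fun i => \sum_k (m1 i k * y (i, k) + m2 k i * y (k, i))).
have collect (g : I -> R) :
    \sum_i (\sum_k (m1 i k * y (i, k) + m2 k i * y (k, i))) * g i =
    \sum_ik y ik * (m1 ik.1 ik.2 * g ik.1 + m2 ik.1 ik.2 * g ik.2).
  transitivity (\sum_i \sum_k m1 i k * y (i, k) * g i +
                \sum_i \sum_k m2 k i * y (k, i) * g i).
    rewrite -big_split; apply: eq_bigr => i _ /=.
    by rewrite mulr_suml -big_split; apply: eq_bigr => k _ /=; ring.
  rewrite [X in _ + X]exchange_big -big_split /=.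
  transitivity (\sum_i \sum_k y (i, k) * (m1 i k * g i + m2 i k * g k)).
    apply: eq_bigr => i _; rewrite -big_split; apply: eq_bigr => k _ /=.
    by ring.
  by rewrite pair_bigA; apply: eq_bigr => -[].
split.
- by move=> i; apply: sumr_ge0 => k _; rewrite addr_ge0 ?mulr_ge0.
- move=> j; rewrite collect; case: (unliftP ord0 j) => [j' ->|->].
    exact: yA.
  by apply: big1 => ik _; rewrite m_a mulr0.
- by rewrite collect.
Qed.

(** Sign constraints on [z] become additional rows - z_j <= 0. Dropping their nonnegative
    multipliers turns the equalities of the certificate into inequalities. *)
Lemma farkas {R : realFieldType} {I J : finType} (A : I -> J -> R) (b : I -> R) :
  (exists z : J -> R, (forall j, 0 <= z j) /\
     forall i, \sum_j A i j * z j <= b i) \/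
  (exists y : I -> R, [/\ forall i, 0 <= y i,
     forall j, 0 <= \sum_i y i * A i j & \sum_i y i * b i < 0]).
Proof.
pose A' (i : I + 'I_#|J|) k :=
  match i with inl i => A i (enum_val k) | inr l => - (l == k)%:R end.
pose b' (i : I + 'I_#|J|) := if i is inl i then b i else 0.
case: (farkas_ord _ _ A' b') => [[z zb]|[y [y_ge0 yA yb]]].
  left; exists (z \o enum_rank); split=> [j|i].
    have := zb (inr (enum_rank j)); rewrite /= (bigD1 (enum_rank j)) //=.
    rewrite eqxx mulN1r big1 => [|k /negPf nk]; last first.
      by rewrite eq_sym nk oppr0 mul0r.
    by rewrite addr0 oppr_le0.
  apply: le_trans (zb (inl i)); rewrite (reindex (@enum_val _ J)) /=; last first.
    by apply: onW_bij; exact: enum_val_bij.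
  by apply: ler_sum => k _; rewrite enum_valK.
right; exists (y \o inl); split=> [i|j|] /=; first exact: y_ge0.
  have := yA (enum_rank j); rewrite big_sumType /= enum_rankK.
  rewrite [X in _ + X](bigD1 (enum_rank j)) //= eqxx mulrN1.
  rewrite [X in _ + (_ + X)]big1 => [|k /negPf ->]; last by rewrite oppr0 mulr0.
  by have := y_ge0 (inr (enum_rank j)); lra.
by move: yb; rewrite big_sumType /= [X in _ + X]big1 ?addr0 // => k; rewrite mulr0.
Qed.

Lemma sum_option {M : nmodType} {I : finType} (F : option I -> M) :
  \sum_i F i = F None + \sum_i F (Some i).
Proof.
rewrite (bigD1 None) //=; congr (_ + _).
rewrite (reindex_omap Some id) => [|[i|]] //=.
by apply: eq_bigl => i; rewrite eqxx.
Qed.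

(** The supremum of the objective is finite; demanding that it be reached adds one row to the
    system. A Farkas certificate against the extended system would bound the objective by a constant
    strictly below that supremum. *)
Lemma lp_max_attained {R : realType} {I J : finType} (A : I -> J -> R)
    (b : I -> R) (g : J -> R) (M : R) (z0 : J -> R) :
  let feasible z := (forall j, 0 <= z j) /\ forall i, \sum_j A i j * z j <= b i in
  feasible z0 -> (forall z, feasible z -> \sum_j g j * z j <= M) ->
  exists2 z, feasible z &
    forall z', feasible z' -> \sum_j g j * z' j <= \sum_j g j * z j.
Proof.
move=> feasible fz0 gM.
pose S := [set \sum_j g j * z j | z in feasible]%classic.
have supS : has_sup S.
  by split; [exists (\sum_j g j * z0 j), z0|exists M => _ [z fz <-]; exact: gM].
pose A' i j := if i is Some i then A i j else - g j.
pose b' i := if i is Some i then b i else - sup S.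
have sumN z : \sum_j A' None j * z j = - \sum_j g j * z j.
  by rewrite -sumrN; apply: eq_bigr => j _; rewrite /= mulNr.
case: (farkas A' b') => [[z [z_ge0 zb]]|[y [y_ge0 yA yb]]].
  exists z => [|z' fz']; first by split=> // i; exact: (zb (Some i)).
  have := zb None; rewrite sumN /= lerN2; apply: le_trans.
  by apply: (ub_le_sup supS.2); exists z'.
have opt z : feasible z -> y None * \sum_j g j * z j <=
    \sum_i y (Some i) * b i.
  case=> z_ge0 zb.
  have : 0 <= \sum_j (\sum_i y i * A' i j) * z j.
    by apply: sumr_ge0 => j _; rewrite mulr_ge0.
  under eq_bigr => j _ do rewrite mulr_suml.
  rewrite exchange_big /= sum_option /=.
  have -> : \sum_j y None * - g j * z j = - (y None * \sum_j g j * z j).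
    by rewrite mulr_sumr -sumrN; apply: eq_bigr => j _; ring.
  rewrite addrC subr_ge0 => /le_trans; apply.
  apply: ler_sum => i _.
  under eq_bigr => j _ do rewrite -mulrA.
  by rewrite -mulr_sumr ler_wpM2l.
move: yb; rewrite sum_option /= mulrN => yb.
(* With multiplier 0 on the objective row the certificate would already refute the feasible point
   [z0]; otherwise dividing by it yields the contradictory bound on [sup S]. *)
have [y0|y0] := eqVneq (y None) 0.
  by have := opt _ fz0; rewrite y0 in yb *; lra.
have yN : 0 < y None by rewrite lt_def y0 y_ge0.
have : sup S <= (\sum_i y (Some i) * b i) / y None.
  apply: ge_sup supS.1 _ => _ [z fz <-].
  by rewrite ler_pdivlMr // mulrC; exact: opt.
by rewrite ler_pdivlMr //; lra.
Qed.

(** * Laminar families *)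

Definition laminar {R : realType} {T : finType} (z : {set T} -> R) : Prop :=
  forall A B : {set T}, z A != 0 -> z B != 0 ->
    (A :&: B != finset.set0)%SET -> (A \subset B) || (B \subset A).

Lemma sum_mul_delta {R : pzSemiRingType} {J : finType} (k : J -> R) j0 :
  \sum_j k j * (j == j0)%:R = k j0.
Proof.
rewrite (bigD1 j0) //= eqxx mulr1 big1 ?addr0 // => j /negPf ->.
by rewrite mulr0.
Qed.

(** Uncrossing preserves the sum of the two sizes but spreads them further apart, so the sum of
    squares grows by strict convexity. *)
Lemma card_uncross_lt {T : finType} (A B : {set T}) :
  ~~ (A \subset B) -> ~~ (B \subset A) ->
  (#|A| ^ 2 + #|B| ^ 2 < #|A :&: B|%SET ^ 2 + #|A :|: B|%SET ^ 2)%N.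
Proof.
move=> nAB nBA; have := cardsUI A B.
have : (#|A :&: B|%SET < #|A|)%N.
  by apply: proper_card; rewrite properE finset.subsetIl finset.subsetI subxx nAB.
have : (#|A :&: B|%SET < #|B|)%N.
  by apply: proper_card; rewrite properE finset.subsetIr finset.subsetI subxx andbT nBA.
by nia.
Qed.

(** Instead of iterating uncrossing steps, take a weighting that maximizes the sum of |U|^2 z_U
    among those increasing no load [g i]. Replacing two crossing sets of its support by their
    intersection and union would raise this potential. *)
Lemma uncrossing {R : realType} {T I : finType} (G : pred {set T})
    (g : I -> {set T} -> R) (z : {set T} -> R) :
    (forall A B, G A -> G B -> (A :&: B != finset.set0)%SET ->
      G (A :&: B)%SET /\ G (A :|: B)%SET) ->
    (forall i A B, G A -> G B -> (A :&: B != finset.set0)%SET ->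
      g i (A :&: B)%SET + g i (A :|: B)%SET <= g i A + g i B) ->
    (forall U, 0 <= z U) ->
  exists z' : {set T} -> R,
    [/\ forall U, 0 <= z' U, forall U, z' U != 0 -> G U, laminar z'
      & forall i, \sum_(U | G U) g i U * z' U <= \sum_(U | G U) g i U * z U].
Proof.
move=> Gclosed g_submod z_ge0.
(* Row [None] bounds the total weight, which makes the potential bounded; an uncrossing step leaves
   that weight unchanged. *)
pose k (i : option I) U : R := if G U then (if i is Some i then g i U else 1) else 0.
pose h U : R := if G U then (#|U| ^ 2)%:R else 0.
pose M : R := (#|T| ^ 2)%:R * \sum_U k None U * z U.
pose b i := \sum_U k i U * z U.
have zfeas : (forall U, 0 <= z U) /\ forall i, \sum_U k i U * z U <= b i by [].
have hM z1 : (forall U, 0 <= z1 U) /\ (forall i, \sum_U k i U * z1 U <= b i) ->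
    \sum_U h U * z1 U <= M.
  case=> z1_ge0 z1b.
  apply: (@le_trans _ _ ((#|T| ^ 2)%:R * \sum_U k None U * z1 U)); last first.
    by rewrite ler_wpM2l ?ler0n.
  rewrite mulr_sumr; apply: ler_sum => U _; rewrite mulrA ler_wpM2r // /h /k.
  case: ifP => _; rewrite ?mulr0 // mulr1 ler_nat leq_exp2r //.
  exact: max_card.
have [z0 [z0_ge0 z0b] z0max] := lp_max_attained k b h M z zfeas hM.
(* Outside [G] both rows and objective vanish, so the maximizer is arbitrary there and is reset to
   0. *)
exists (fun U => if G U then z0 U else 0); split.
- by move=> U; case: ifP.
- by move=> U; case: ifP => //; rewrite eqxx.
- move=> A B; case: ifP => GA; rewrite ?eqxx // => zA.
  case: ifP => GB; rewrite ?eqxx // => zB AB.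
  apply/negPn/negP; rewrite negb_or => /andP[nAB nBA].
  have [GI GU] := Gclosed A B GA GB AB.
  have neqAB : A != B by apply: contraNneq nAB => ->.
  pose eps := Num.min (z0 A) (z0 B).
  have eps_gt0 : 0 < eps by rewrite lt_min !lt_def zA zB !z0_ge0.
  have [epsA epsB] : eps <= z0 A /\ eps <= z0 B by rewrite !ge_min !lexx orbT.
  (* Weight [eps], the most that both sets can give, moves from [A] and [B] to their intersection
     and union. *)
  pose z1 U := z0 U - eps * (U == A)%:R - eps * (U == B)%:R +
    eps * (U == A :&: B)%SET%:R + eps * (U == A :|: B)%SET%:R.
  have sum_z1 w : \sum_U w U * z1 U = \sum_U w U * z0 U +
      eps * (w (A :&: B)%SET + w (A :|: B)%SET - (w A + w B)).
    rewrite -(sum_mul_delta w A) -(sum_mul_delta w B).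
    rewrite -(sum_mul_delta w (A :&: B)%SET) -(sum_mul_delta w (A :|: B)%SET).
    rewrite -!big_split -sumrB mulr_sumr -big_split; apply: eq_bigr => U _ /=.
    by rewrite /z1; ring.
  have z1_ge0 U : 0 <= z1 U.
    have e0 (P : bool) : 0 <= eps * P%:R by rewrite mulr_ge0 ?ler0n ?ltW.
    rewrite /z1 addr_ge0 // addr_ge0 //; case: (eqVneq U A) => [->|_].
      by rewrite (negPf neqAB) mulr1 mulr0 subr0 subr_ge0.
    rewrite mulr0 subr0; case: eqP => [->|_]; rewrite ?mulr1 ?subr_ge0 //.
    by rewrite mulr0.
  have z1b i : \sum_U k i U * z1 U <= b i.
    rewrite sum_z1; apply: le_trans (z0b i).
    rewrite gerDl pmulr_rle0 // subr_le0 /k GA GB GI GU.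
    by case: i => // i; exact: g_submod.
  have := z0max z1 (conj z1_ge0 z1b); rewrite sum_z1 gerDl pmulr_rle0 // subr_le0.
  by rewrite /h GA GB GI GU -!natrD ler_nat leqNgt card_uncross_lt.
- move=> i; have := z0b (Some i); rewrite /b /k.
  congr (_ <= _); rewrite [RHS]big_mkcond; apply: eq_bigr => U _ /=;
    by case: ifP => _; rewrite ?mul0r.
Qed.

(* The sets are charged in order of increasing size, each as much as the
   remaining budgets [a] allow. *)
Lemma greedy_charge {R : realType} {T : finType} (N : {set T})
    (z : {set T} -> R) (a : T -> R) :
    (forall U, 0 <= z U) -> {in N, forall s, 0 <= a s} ->
  exists e : {set T} -> R,
    [/\ forall U, 0 <= e U <= z U,
        {in N, forall s, \sum_(U : {set T} | s \in U) e U <= a s}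
      & forall U, e U < z U -> exists s, [/\ s \in N, s \in U
          & a s <= \sum_(W : {set T} | (s \in W) && (#|W| <= #|U|)%N) e W]].
Proof.
move=> z_ge0 a_ge0.
pose size_le (A B : {set T}) := (#|A| <= #|B|)%N.
(* Induction on prefixes of the list of all sets sorted by size: the set appended last is a largest
   one so far, and sets not yet reached have charge 0. *)
suff charge (l : seq {set T}) : uniq l -> pairwise size_le l ->
    exists e : {set T} -> R, [/\ forall U, 0 <= e U <= z U,
        {in N, forall s, \sum_(U : {set T} | s \in U) e U <= a s},
        forall U, U \notin l -> e U = 0
      & forall U, U \in l -> e U < z U -> exists s, [/\ s \in N, s \in U
          & a s <= \sum_(W : {set T} | (s \in W) && size_le W U) e W]].
  have size_tr : transitive size_le by move=> ? ? ?; exact: leq_trans.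
  have [||e [e_z e_a _ tight]] := charge (sort size_le (enum {set T})).
  - by rewrite sort_uniq enum_uniq.
  - rewrite -sorted_pairwise //; apply: sort_sorted => A B; exact: leq_total.
  - by exists e; split=> // U; apply: tight; rewrite mem_sort mem_enum.
elim/last_ind: l => [|l U0 IH].
  move=> _ _; exists (fun=> 0); split=> // [U|s sN]; first by rewrite lexx z_ge0.
  by rewrite big1 ?a_ge0.
rewrite rcons_uniq pairwise_rcons => /andP[U0l ul] /andP[/allP lU0 /(IH ul)].
case=> e [e_z e_a e0 tight].
pose slack s := a s - \sum_(U : {set T} | s \in U) e U.
have [m [m_ge0 m_z m_slack m_tight]] : exists m, [/\ 0 <= m, m <= z U0,
    forall s, s \in N -> s \in U0 -> m <= slack s
  & m < z U0 -> exists s, [/\ s \in N, s \in U0 & slack s <= m]].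
  case: (pickP [pred s in N | s \in U0]) => [s0 Ps0|P0]; last first.
    exists (z U0); split=> // [s sN sU0|]; last by rewrite ltxx.
    by have := P0 s; rewrite /= sN sU0.
  case: (arg_minP slack Ps0) => s /andP[sN sU0] smin.
  (* The new set takes its full weight, or the smallest remaining budget among its elements in [N]
     if that is less; the element attaining the minimum is then exhausted. *)
  exists (Num.min (z U0) (slack s)); split.
  - by rewrite le_min z_ge0 subr_ge0 e_a.
  - by rewrite ge_min lexx.
  - by move=> s' s'N s'U0; rewrite ge_min smin ?orbT //= s'N.
  - move=> mlt; exists s; split=> //; move: mlt.
    by rewrite minElt; case: ifP; rewrite ?ltxx.
pose e' U := e U + m * (U == U0)%:R.
have ee' U : e U <= e' U by rewrite lerDl mulr_ge0 ?ler0n.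
have sum_e' s : \sum_(U : {set T} | s \in U) e' U =
    \sum_(U : {set T} | s \in U) e U + m * (s \in U0)%:R.
  rewrite big_split -mulr_sumr /=; congr (_ + _ * _).
  case: (boolP (s \in U0)) => sU0.
    rewrite (bigD1 U0) //= eqxx big1 ?addr0 // => U /andP[_ /negPf ->] //.
  by rewrite big1 // => U sU; case: eqP => // UU0; rewrite -UU0 sU in sU0.
exists e'; split.
- move=> U; rewrite /e'; case: (eqVneq U U0) => [->|_].
    by rewrite e0 // mulr1 add0r m_ge0.
  by rewrite mulr0 addr0.
- move=> s sN; rewrite sum_e'; case: (boolP (s \in U0)) => sU0.
    by have := m_slack s sN sU0; rewrite /slack mulr1; lra.
  by rewrite mulr0 addr0 e_a.
- move=> U; rewrite mem_rcons inE negb_or => /andP[UU0 Ul].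
  by rewrite /e' e0 // (negPf UU0) mulr0 addr0.
- move=> U; rewrite mem_rcons inE => /predU1P[->|Ul] lt_z.
    have /m_tight[s [sN sU0 sm]] : m < z U0.
      by move: lt_z; rewrite /e' e0 // eqxx mulr1 add0r.
    exists s; split=> //.
    (* Sets larger than [U0] come later in the order, so they carry no charge yet and the size
       restriction is vacuous. *)
    have -> : \sum_(W : {set T} | (s \in W) && size_le W U0) e' W =
        \sum_(W : {set T} | s \in W) e' W.
      rewrite big_mkcondr; apply: eq_bigr => W _ /=.
      case: ifPn => // WU0; rewrite /e' e0.
        case: eqP => [WU|_]; last by rewrite mulr0 addr0.
        by rewrite WU /size_le leqnn in WU0.
      by apply: contra WU0 => /lU0.
    by rewrite sum_e' sU0 mulr1; move: sm; rewrite /slack; lra.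
  have [s [sN sU sa]] := tight U Ul (le_lt_trans (ee' U) lt_z).
  exists s; split=> //; apply: (le_trans sa).
  by apply: ler_sum => W _.
Qed.

(* Among the sets avoiding t that the greedy charging does not fill, the
   inclusion-minimal ones are disjoint; picking an exhausted element in each of
   them gives the set S whose packing constraint bounds the uncharged part. *)
Lemma laminar_star_split {R : realType} {T : finType} (N : {set T})
    (z : {set T} -> R) (a b : T -> R) :
    (forall U, 0 <= z U) -> laminar z ->
    {in N, forall s, 0 <= a s} -> {in N, forall t, 0 <= b t} ->
    (forall t (S : {set T}), t \in N -> S \subset N -> t \notin S ->
       S != finset.set0 ->
       \sum_(U : {set T} | (t \notin U) && (U :&: S != finset.set0)%SET) z U
         <= \sum_(s in S) a s + b t) ->
  exists e : {set T} -> R,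
    [/\ forall U, 0 <= e U <= z U,
        {in N, forall s, \sum_(U : {set T} | s \in U) e U <= a s}
      & {in N, forall t, \sum_(U : {set T} | t \notin U) (z U - e U) <= b t}].
Proof.
move=> z_ge0 z_lam a_ge0 b_ge0 packing.
have [e [e_z e_a tight]] := greedy_charge N z a z_ge0 a_ge0.
have e_ge0 U : 0 <= e U by have /andP[] := e_z U.
exists e; split=> // t tN.
(* [w U] is an exhausted element of an unfilled [U]; its value on filled sets is arbitrary. *)
have /choice[w wP] : forall U, exists s, e U < z U -> [/\ s \in N, s \in U
    & a s <= \sum_(W : {set T} | (s \in W) && (#|W| <= #|U|)%N) e W].
  by move=> U; case: (ltP (e U) (z U)) => [/tight[s]|_]; [exists s|exists t].
have lamP A B s : 0 < z A -> 0 < z B -> s \in A -> s \in B ->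
    (A \subset B) || (B \subset A).
  move=> zA zB sA sB; apply: z_lam; rewrite ?gt_eqF //.
  by apply/set0Pn; exists s; rewrite finset.in_setI sA.
have e_z0 W : e W != 0 -> 0 < z W.
  by have /andP[? ?] := e_z W => eW; apply: lt_le_trans (_ : e W <= _);
    rewrite // lt_def eW.
pose D := [pred U : {set T} | (t \notin U) && (e U < z U)].
pose S := [set w U | U in [set U | minset D U]]%SET.
have DP U : D U -> [/\ t \notin U, e U < z U & 0 < z U].
  by move=> /andP[-> ez]; rewrite (le_lt_trans (e_ge0 U) ez).
have sub_of_tight U W : e U < z U -> e W != 0 -> w U \in W -> W \subset U.
  move=> ez eW wW; have [wN wU aw] := wP _ ez.
  have zU := le_lt_trans (e_ge0 U) ez.
  have /orP[//|UW] := lamP W U (w U) (e_z0 _ eW) zU wW wU.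
  case: (leqP #|W| #|U|) => [WU|UltW].
    by have /eqP <- : U == W by rewrite eqEcard UW.
  have := e_a _ wN; rewrite leNgt => /negP[].
  apply: (le_lt_trans aw).
  rewrite [ltRHS](bigID (fun W : {set T} => (#|W| <= #|U|)%N)) /=.
  rewrite ltrDl (bigD1 W) /=; last by rewrite wW -ltnNge.
  by apply: ltr_wpDr; [apply: sumr_ge0 | rewrite lt_def eW e_ge0].
(* Charged sets through [w U] and of size at most |U| lie inside [U], hence avoid [t]. *)
have a_le s : s \in S -> a s <= \sum_(W : {set T} | (s \in W) && (t \notin W)) e W.
  case/imsetP => U; rewrite inE => /minsetP[/DP[tU ez _] _] ->.
  have [_ _ aw] := wP _ ez; apply: (le_trans aw).
  rewrite big_mkcondr [leRHS]big_mkcondr; apply: ler_sum => W wW /=.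
  have [->|eW] := eqVneq (e W) 0; first by rewrite !if_same.
  have /fintype.subsetP WU := sub_of_tight U W ez eW wW.
  by rewrite (contra (WU t) tU); case: ifP.
(* If [W] contains [w U1] and [w U2], then [U1] and [U2] intersect, so they are nested, and
   minimality makes them equal. Thus no charge is counted twice when the budgets over [S] are
   summed. *)
have S_le1 W : e W != 0 -> (#|W :&: S|%SET <= 1)%N.
  move=> eW; apply/card_le1_eqP => s1 s2.
  rewrite !finset.in_setI => /andP[s1W /imsetP[U1 minU1 eq1]].
  move=> /andP[s2W /imsetP[U2 minU2 eq2]]; subst s1 s2.
  rewrite !inE in minU1 minU2.
  have /DP[_ ez1 z1] := minsetp minU1; have /DP[_ ez2 z2] := minsetp minU2.
  have [_ w1 _] := wP _ ez1; have [_ w2 _] := wP _ ez2.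
  have /fintype.subsetP WU2 := sub_of_tight _ _ ez2 eW s2W.
  have /orP[U12|U21] := lamP _ _ _ z1 z2 w1 (WU2 _ s1W).
    by rewrite (minsetinf minU2 (minsetp minU1) U12).
  by rewrite (minsetinf minU1 (minsetp minU2) U21).
have hits U : D U -> (U :&: S != finset.set0)%SET.
  move=> DU; have [M minM MU] := minset_exists DU.
  have /DP[_ ez _] := minsetp minM; have [_ wM _] := wP _ ez.
  apply/set0Pn; exists (w M); rewrite finset.in_setI (fintype.subsetP MU) //=.
  by apply: imset_f; rewrite inE.
have [S0|S0] := eqVneq S finset.set0.
  rewrite big1 ?b_ge0 // => U tU.
  have : ~~ D U by apply/negP => /hits; rewrite S0 finset.setI0 eqxx.
  rewrite /= tU -leNgt => z_e; apply/eqP; rewrite subr_eq0 eq_le z_e.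
  by have /andP[] := e_z U.
have S_N : S \subset N.
  apply/fintype.subsetP => s /imsetP[U]; rewrite inE => /minsetp/DP[_ ez _] ->.
  by have [] := wP _ ez.
have tS : t \notin S.
  apply/negP => /imsetP[U]; rewrite inE => /minsetp/DP[tU ez _] tw.
  by have [_] := wP _ ez; rewrite -tw (negPf tU).
have packS := packing t S tN S_N tS S0.
have sum_a : \sum_(s in S) a s <=
    \sum_(U : {set T} | (t \notin U) && (U :&: S != finset.set0)%SET) e U.
  apply: (le_trans (ler_sum _ a_le)).
  rewrite (exchange_big_dep (fun W : {set T} => t \notin W)) /=; last first.
    by move=> s W _ /andP[].
  rewrite [leRHS]big_mkcondr; apply: ler_sum => W tW /=.
  have -> : \sum_(s in S | (s \in W) && (t \notin W)) e W = e W *+ #|W :&: S|%SET.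
    rewrite -sumr_const; apply: eq_bigl => s.
    by rewrite finset.in_setI tW andbT andbC.
  have [->|eW] := eqVneq (e W) 0; first by rewrite mul0rn if_same.
  have := S_le1 W eW; rewrite -cards_eq0.
  by case: #|_| => [|[|//]] _.
have sum_D : \sum_(U : {set T} | t \notin U) (z U - e U) <=
    \sum_(U : {set T} | (t \notin U) && (U :&: S != finset.set0)%SET) (z U - e U).
  rewrite [leRHS]big_mkcondr; apply: ler_sum => U tU /=.
  case: ifPn => // nS; rewrite subr_le0 leNgt; apply: contra nS => ez.
  by apply: hits; rewrite /= tU.
by move: sum_D; rewrite !sumrB; lra.
Qed.

(** * Stars *)

Lemma adj_sym {V : finType} (F : {set {set V}}) u v : adj F u v = adj F v u.
Proof. by rewrite /adj finset.setUC. Qed.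

Lemma simple_adj_neq {V : finType} (E : {set {set V}}) u v :
  simple_graph E -> adj E u v -> u != v.
Proof. by move=> hE /hE; rewrite cards2; case: eqP. Qed.

Lemma quasi_bipartite_nbr {V : finType} (E : {set {set V}}) (R : {set V}) u v :
  quasi_bipartite E R -> adj E u v -> v \notin R -> u \in R.
Proof. by move=> hqb /hqb[//|->]. Qed.

Definition star {V : finType} (x : V) (L : {set V}) : {set {set V}} :=
  [set [set x; l]%SET | l in L]%SET.

(** The sink [t] is meant to be one of the leaves [L]. These stars are the components whose packing
    constraints are tested in [laminar_dual_bound]. *)
Definition dstar {V : finType} (x : V) (L : {set V}) (t : V) : rooted_subgraph V :=
  ((x |: L)%SET, star x L, t).

Section Star.
Context {V : finType} {x : V} {L : {set V}}.
Context (xL : x \notin L).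

Lemma adj_star u v :
  adj (star x L) u v = (u == x) && (v \in L) || (v == x) && (u \in L).
Proof.
apply/imsetP/idP => [[l lL /setP uv]|].
  have lx : (l == x) = false by apply/negP => /eqP lx; move: xL; rewrite -lx lL.
  have := uv x; rewrite !inE eqxx => /orP[] /eqP e; rewrite -e eqxx /=.
    have := uv l; rewrite !inE eqxx orbT -e lx /= => /eqP <-.
    by rewrite lL.
  have := uv l; rewrite !inE eqxx orbT -e lx orbF => /eqP <-.
  by rewrite lL orbT.
by case/orP => /andP[/eqP -> ?]; [exists v | exists u; rewrite // finset.setUC].
Qed.

Lemma degree_star_center : degree (star x L) x = #|L|.
Proof.
rewrite /degree -(card_in_imset (f := fun l => [set x; l]%SET) (D := mem L)).
  apply: eq_card => e; rewrite !inE andb_idr //.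
  by case/imsetP => l _ ->; rewrite !inE eqxx.
move=> l1 l2 l1L l2L /setP /(_ l1); rewrite !inE eqxx orbT.
case: eqP => [l1x|_ /esym/eqP //].
by move: xL; rewrite -l1x l1L.
Qed.

Lemma degree_star_leaf l : l \in L -> degree (star x L) l = 1%N.
Proof.
move=> lL; apply/eqP/cards1P; exists [set x; l]%SET; apply/setP => e.
rewrite !inE; apply/andP/eqP => [[/imsetP[l' l'L ->]]|->].
  rewrite !inE => /orP[/eqP lx|/eqP -> //].
  by move: xL; rewrite -lx lL.
by split; [exact: imset_f | rewrite !inE eqxx orbT].
Qed.

(** Every edge has exactly one end at the centre. Hence of three consecutive vertices on a cycle of
    length at least 3 the middle one is [x], and the next edge would have to return to [x]. *)
Lemma star_acyclic : acyclic (star x L).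
Proof.
have xE u v : adj (star x L) u v -> (u == x) (+) (v == x).
  rewrite adj_star => /orP[] /andP[-> vL]; rewrite /= ?addbT.
    by apply/negP => /eqP vx; move: xL; rewrite -vx vL.
  by apply/negP => /eqP vx; move: xL; rewrite -vx vL.
have notx u v w : u != v -> v != w -> u != w ->
    adj (star x L) u v -> adj (star x L) v w -> u != x /\ w != x /\ v = x.
  move=> uv vw uw /xE + /xE; case: (eqVneq v x) => [<-|vx].
    by rewrite (negPf uv) eq_sym (negPf vw).
  by rewrite /= !addbF => /eqP ux /eqP wx; rewrite ux wx eqxx in uw.
move=> [|u [|v [|w p]]] //= /andP[/= /and3P[uv vw wp]].
rewrite !inE !negb_or => /and3P[/and3P[u_v u_w up] /andP[v_w vp] _].
have [ux [wx vx]] := notx _ _ _ u_v v_w u_w uv vw; subst v.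
case: p wp up vp => [|y p] /=.
  by rewrite andbT => /xE; rewrite (negPf wx) (negPf ux).
move=> /andP[/xE wy _] _; rewrite inE negb_or eq_sym => /andP[yx _].
by rewrite (negPf wx) (negPf yx) in wy.
Qed.

Context {E : {set {set V}}} {R : {set V}} {t : V}.
Context (tL : t \in L).

(** The centre has degree [#|L|], so it is a leaf exactly when [L] is a singleton. The two branches
    cover an edge between two terminals and a genuine star around a Steiner vertex. *)
Lemma dstar_full_component :
    L \subset R -> {in L, forall l, adj E x l} ->
    (if x \in R then #|L| == 1 else #|L| != 1)%N ->
  dstar x L t \in dir_full_components E R.
Proof.
move=> /fintype.subsetP LR LE xR.
rewrite inE; apply/asboolP; split=> /=; [|by rewrite /sink !inE tL orbT|exact: LR].
rewrite /dverts /dedges /=.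
have conn u v : u \in (x |: L)%SET -> v \in (x |: L)%SET ->
    connect (adj (star x L)) u v.
  move=> uL vL; apply: (@connect_trans _ _ x).
    move: uL; rewrite !inE => /predU1P[-> //|uL].
    by apply: connect1; rewrite adj_star eqxx uL orbT.
  move: vL; rewrite !inE => /predU1P[-> //|vL].
  by apply: connect1; rewrite adj_star eqxx vL.
split; first split.
- by apply/set0Pn; exists x; rewrite !inE eqxx.
- by apply/fintype.subsetP => _ /imsetP[l lL ->]; exact: LE.
- move=> _ /imsetP[l lL ->]; apply/fintype.subsetP => u.
  by rewrite !inE => /orP[|/eqP ->]; rewrite ?lL ?orbT // => ->.
- exact: conn.
- exact: star_acyclic.
- move=> v; rewrite !inE => /predU1P[->|/LR //].
  rewrite degree_star_center => L1.
  by move: xR; rewrite L1; case: ifP.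
- move=> v; rewrite !inE => /predU1P[->|vL]; last by rewrite degree_star_leaf.
  by rewrite degree_star_center => /eqP/negPf L1; move: xR; rewrite L1; case: ifP.
Qed.

(** A simple path that leaves the centre stops at its first leaf, since going on would revisit the
    centre; one that starts at a leaf and moves to the centre cannot start at its own endpoint
    [t]. *)
Lemma darcs_dstar :
  darcs (dstar x L t) \subset ((x, t) |: [set (s, x) | s in L :\ t])%SET.
Proof.
apply/fintype.subsetP => -[u v].
rewrite [in X in X -> _]inE => /asboolP[p [puv upuv last_t]].
move: puv upuv last_t => /= /andP[uv vp] /andP[uvp vpu] last_t.
rewrite !inE; move: uv; rewrite adj_star.
case/orP => /andP[/eqP ex mL]; move: vp uvp vpu last_t; rewrite ex.
  case: p => [|w p] /=; first by move=> _ _ _ ->; rewrite eqxx.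
  move=> /andP[+ _]; rewrite adj_star inE !negb_or => /orP[|] /andP[/eqP e _].
    by move: xL; rewrite -e mL.
  by rewrite e eqxx andbF.
move=> _ uxp _ last_t; apply/orP; right; apply: imset_f.
rewrite !inE mL andbT; apply: contraNneq uxp => ->.
by rewrite -last_t mem_last.
Qed.

Lemma comp_cost_dstar {RR : realType} (c : V * V -> RR) :
    {in L, forall l, 0 <= c (l, x) /\ 0 <= c (x, l)} ->
  comp_cost c (dstar x L t) <= \sum_(s in L :\ t) c (s, x) + c (x, t).
Proof.
move=> c_ge0; pose D := ((x, t) |: [set (s, x) | s in L :\ t])%SET.
have cD a : a \in D -> 0 <= c a.
  rewrite !inE => /predU1P[->|/imsetP[s]]; first by have [] := c_ge0 t tL.
  by rewrite !inE => /andP[_ /c_ge0[? _]] ->.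
apply: (@le_trans _ _ (\sum_(a in D) c a)).
  rewrite [leRHS](big_setID (darcs (dstar x L t))) /=.
  rewrite (finset.setIidPr darcs_dstar) lerDl; apply: sumr_ge0 => a.
  by rewrite finset.in_setD => /andP[_ /cD].
rewrite big_setU1 /= => [|]; last first.
  apply/imsetP => -[s]; rewrite !inE => /andP[_ sL] [xs _].
  by move: xL; rewrite xs sL.
by rewrite big_imset /= 1?addrC // => s1 s2 _ _ [].
Qed.

Lemma dstar_Delta_plus (U : {set V}) s :
    dstar x L t \in dir_full_components E R ->
    t \notin U -> s \in dverts (dstar x L t) -> s \in R -> s \in U ->
  dstar x L t \in Delta_plus E R U.
Proof.
move=> dK tU sK sR sU; rewrite inE dK /= tU; apply/existsP; exists s.
by rewrite finset.in_setD1 finset.in_setI sK sR sU (memPn tU).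
Qed.

End Star.

(** * Comparing the relaxations *)

(** In a quasi-bipartite graph an arc that is not between terminals has exactly one Steiner end, and
    is grouped under it. *)
Lemma sum_arcs_steiner {M : nmodType} {V : finType} (E : {set {set V}})
    (R : {set V}) (F : V * V -> M) : quasi_bipartite E R ->
  \sum_(a in arcs E) F a =
    \sum_(a in arcs E | (a.1 \in R) && (a.2 \in R)) F a +
    \sum_(v | v \notin R) (\sum_(s | adj E s v) F (s, v) +
                           \sum_(t | adj E v t) F (v, t)).
Proof.
move=> hqb; rewrite (bigID (fun a => (a.1 \in R) && (a.2 \in R))) /=.
congr (_ + _); rewrite big_split /= (bigID (fun a => a.1 \in R)) /=.
congr (_ + _).
  rewrite (exchange_big_dep xpredT) //= pair_big_dep /=.
  apply: eq_big => [[u v]|[u v] _ //] /=; rewrite inE /=.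
  rewrite negb_and; case: (boolP (u \in R)) => uR /=.
    by rewrite andbT andbC.
  rewrite !andbF; apply/esym/negbTE/negP => /andP[vR uv].
  by rewrite (quasi_bipartite_nbr _ _ _ _ hqb uv vR) in uR.
rewrite pair_big_dep /=; apply: eq_big => [[u v]|[u v] _ //] /=.
by rewrite inE negb_and /=; case: (u \in R); rewrite /= ?andbF ?andbT.
Qed.

(** A weak duality across the two programs: [z] is distributed over the arcs by coefficients [k U a]
    that sum to at most [c a] over all [U], while for each fixed [U] they pay for [z U] times the
    value of some cut of (BCR_f). *)
Lemma laminar_dual_bound {RR : realType} {V : finType} (E : {set {set V}})
    (R : {set V}) (r : V) (c : V * V -> RR) (f z : {set V} -> RR)
    (x : V * V -> RR) :
    simple_graph E -> r \in R -> quasi_bipartite E R ->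
    (forall a, a \in arcs E -> 0 <= c a) ->
    BCR_feasible E R r f x ->
    (forall U, 0 <= z U) -> laminar z ->
    (forall U, z U != 0 -> U != finset.set0 /\ U \subset (R :\ r)%SET) ->
    (forall K, K \in dir_full_components E R ->
       \sum_(U | K \in Delta_plus E R U) z U <= comp_cost c K) ->
  \sum_U z U * f U <= BCR_cost E c x.
Proof.
move=> hE hr hqb c_ge0 [x_ge0 x_cut] z_ge0 z_lam z_good packing.
have arcE u v : ((u, v) \in arcs E) = adj E u v by rewrite inE.
have c_adj u v : adj E u v -> 0 <= c (u, v) by rewrite -arcE => /c_ge0.
have RadjE u v : adj E u v -> v \notin R -> u \in R.
  exact: quasi_bipartite_nbr.
(* Whenever a star counts towards every set satisfying [P], its packing constraint bounds the total
   weight of these sets. *)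
have dstar_bound v (L : {set V}) t (P : pred {set V}) :
    v \notin L -> t \in L -> L \subset R -> {in L, forall l, adj E v l} ->
    (if v \in R then #|L| == 1 else #|L| != 1)%N ->
    (forall U, P U -> t \notin U /\
      exists2 s, s \in (v |: L)%SET & (s \in R) && (s \in U)) ->
    \sum_(U | P U) z U <= \sum_(s in L :\ t) c (s, v) + c (v, t).
  move=> vL tL LR LE vR PU.
  have dK := dstar_full_component vL tL LR LE vR.
  have c_le : comp_cost c (dstar v L t) <=
      \sum_(s in L :\ t) c (s, v) + c (v, t).
    by apply: comp_cost_dstar => // l /LE vl; rewrite !c_adj // adj_sym.
  apply: le_trans c_le; apply: le_trans (packing _ dK).
  rewrite big_mkcond [leRHS]big_mkcond; apply: ler_sum => U _ /=.
  case: ifP => [/PU[tU [s sL /andP[sR sU]]]|_]; last by case: ifP.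
  by rewrite (dstar_Delta_plus U s dK tU sL sR sU).
(* Only Steiner vertices need a split; [z] is a dummy value at terminals. *)
have /choice[e eP] : forall v, exists e : {set V} -> RR, v \notin R ->
    [/\ forall U, 0 <= e U <= z U,
        forall s, adj E s v -> \sum_(U : {set V} | s \in U) e U <= c (s, v)
      & forall t, adj E v t ->
          \sum_(U : {set V} | t \notin U) (z U - e U) <= c (v, t)].
  move=> v; case: (boolP (v \in R)) => vR; first by exists z.
  pose N := [set s | adj E s v]%SET.
  have Nc s : s \in N -> 0 <= c (s, v) by rewrite inE => /c_adj.
  have Nc' t : t \in N -> 0 <= c (v, t) by rewrite inE adj_sym => /c_adj.
  have [|e [e_z e_a e_b]] := laminar_star_split N z (fun s => c (s, v))
      (fun t => c (v, t)) z_ge0 z_lam Nc Nc'.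
    (* The required inequality is the packing constraint of the star centred at [v] with leaves [S]
       and [t], directed to [t]. *)
    move=> t S tN /fintype.subsetP SN tS S0.
    have LN l : l \in (t |: S)%SET -> l \in N.
      by rewrite in_setU1 => /predU1P[->|/SN].
    have SE : ((t |: S) :\ t)%SET = S by rewrite setU1K.
    rewrite -[in X in _ <= X]SE.
    apply: dstar_bound.
    - by apply/negP => /LN; rewrite inE => /(simple_adj_neq _ _ _ hE); rewrite eqxx.
    - by rewrite !inE eqxx.
    - by apply/fintype.subsetP => l /LN; rewrite inE => /RadjE; exact.
    - by move=> l /LN; rewrite inE adj_sym.
    - by rewrite (negPf vR) cardsU1 tS eqSS cards_eq0.
    - move=> U /andP[tU /set0Pn[s]]; rewrite finset.in_setI => /andP[sU sS].
      split=> //; exists s; first by rewrite !inE sS !orbT.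
      by rewrite sU andbT; have := SN s sS; rewrite inE => /RadjE; exact.
  exists e => _; split=> // [s sv|t vt]; first by apply: e_a; rewrite inE.
  by apply: e_b; rewrite inE adj_sym.
have e_le v U : v \notin R -> 0 <= e v U <= z U by move=> /eP[].
(* Each Steiner vertex [v] lies outside the set with weight [e v U] and inside with weight
   [z U - e v U]: an arc into [v] is cut in the first case, an arc out of [v] in the second. *)
pose k U (a : V * V) :=
  if a.1 \in R then
    if a.2 \in R then z U * ((a.1 \in U) && (a.2 \notin U))%:R
    else e a.2 U * (a.1 \in U)%:R
  else (z U - e a.1 U) * (a.2 \notin U)%:R.
have k_ge0 U a : a \in arcs E -> 0 <= k U a.
  case: a => u v; rewrite arcE /k /= => uv.
  case: ifPn => uR; last first.
    by rewrite mulr_ge0 ?ler0n // subr_ge0; have /andP[] := e_le u U uR.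
  case: ifPn => vR; rewrite mulr_ge0 ?ler0n //.
  by have /andP[] := e_le v U vR.
have k_le a : a \in arcs E -> \sum_U k U a <= c a.
  case: a => u v; rewrite arcE /k /= => uv.
  have sum_mkb (g : {set V} -> RR) (P : pred {set V}) :
      \sum_U g U * (P U)%:R = \sum_(U | P U) g U.
    rewrite [RHS]big_mkcond; apply: eq_bigr => U _.
    by case: (P U); rewrite ?mulr1 ?mulr0.
  case: (boolP (u \in R)) => uR; last first.
    by rewrite (sum_mkb _ (fun U => v \notin U)); have [_ _] := eP u uR; apply.
  case: (boolP (v \in R)) => vR; last first.
    by rewrite (sum_mkb _ (fun U => u \in U)); have [_ + _] := eP v vR; apply.
  rewrite (sum_mkb _ (fun U => (u \in U) && (v \notin U))).
  (* An arc between terminals is itself a component: the star with centre [u] and single leaf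
     [v]. *)
  have := dstar_bound u [set v]%SET v (fun U => (u \in U) && (v \notin U)).
  rewrite finset.setDv big_set0 add0r; apply.
  - by rewrite inE (simple_adj_neq _ _ _ hE uv).
  - by rewrite inE.
  - by rewrite finset.sub1set.
  - by move=> l; rewrite inE => /eqP ->.
  - by rewrite uR cards1.
  - by move=> U /andP[uU vU]; split=> //; exists u; rewrite ?uR // !inE eqxx.
have k_cut U : z U * f U <= \sum_(a in arcs E) k U a * x a.
  have [->|zU] := eqVneq (z U) 0.
    rewrite mul0r; apply: sumr_ge0 => a aE.
    by rewrite mulr_ge0 ?k_ge0 ?x_ge0.
  have [U0 UR] := z_good U zU.
  have UinR u : u \in U -> u \in R.
    by move=> /(fintype.subsetP UR); rewrite !inE => /andP[].
  pose xin v := \sum_(s | adj E s v) x (s, v) * (s \in U)%:R.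
  pose xout v := \sum_(t | adj E v t) x (v, t) * (t \notin U)%:R.
  (* Each Steiner vertex goes to the side where it adds less to the cut. Its contribution is the
     minimum of [xin v] and [xout v], so [z U] times it is at most any split
     [xin v * e v U + xout v * (z U - e v U)]. *)
  pose U' := (U :|: [set v | (v \notin R) && (xout v <= xin v)])%SET.
  have U'R u : u \in R -> (u \in U') = (u \in U).
    by move=> uR; rewrite !inE uR orbF.
  have U'v v : v \notin R -> (v \in U') = (xout v <= xin v).
    move=> vR; rewrite !inE vR /=.
    by rewrite (negPf (contra (UinR v) vR)).
  have U'IR : (U' :&: R)%SET = U.
    apply/setP => u; rewrite finset.in_setI.
    case: (boolP (u \in R)) => uR; first by rewrite andbT U'R.
    by rewrite andbF; apply/esym/negbTE; apply: contra uR; exact: UinR.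
  have U'valid : valid R r U'.
    rewrite /valid U'IR U0 /=; apply/negP => rU'.
    rewrite U'R // in rU'.
    by have := fintype.subsetP UR r rU'; rewrite !inE eqxx.
  have cutE : \sum_(a in delta_plus E U') x a =
      \sum_(a in arcs E) x a * ((a.1 \in U') && (a.2 \notin U'))%:R.
    rewrite [LHS](eq_bigl (fun a => (a \in arcs E) && ((a.1 \in U') && (a.2 \notin U')))).
      rewrite big_mkcondr; apply: eq_bigr => a _.
      by case: ifP => _; rewrite ?mulr1 ?mulr0.
    by move=> a; rewrite finset.in_set.
  have := x_cut U' U'valid; rewrite U'IR cutE => fU.
  apply: (le_trans (ler_wpM2l (z_ge0 U) fU)).
  rewrite !(sum_arcs_steiner E R) // mulrDr lerD //.
    rewrite mulr_sumr; apply: ler_sum => -[u v] /= /andP[_ /andP[uR vR]].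
    by rewrite /k /= uR vR !U'R //; lra.
  rewrite mulr_sumr; apply: ler_sum => v vR.
  have sum_in w : \sum_(s | adj E s v) x (s, v) * (s \in U)%:R * w = xin v * w.
    by rewrite mulr_suml.
  have sum_out w : \sum_(t | adj E v t) x (v, t) * (t \notin U)%:R * w = xout v * w.
    by rewrite mulr_suml.
  have -> : \sum_(s | adj E s v) k U (s, v) * x (s, v) = xin v * e v U.
    rewrite -sum_in; apply: eq_bigr => s sv.
    by rewrite /k /= (RadjE s v) // (negPf vR); ring.
  have -> : \sum_(t | adj E v t) k U (v, t) * x (v, t) = xout v * (z U - e v U).
    by rewrite -sum_out; apply: eq_bigr => t vt; rewrite /k /= (negPf vR); ring.
  have -> : \sum_(s | adj E s v) x (s, v) * ((s \in U') && (v \notin U'))%:R =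
      xin v * (v \notin U')%:R.
    rewrite -sum_in; apply: eq_bigr => s sv.
    by rewrite U'R ?(RadjE s v) // -mulrA -natrM mulnb.
  have -> : \sum_(t | adj E v t) x (v, t) * ((v \in U') && (t \notin U'))%:R =
      xout v * (v \in U')%:R.
    rewrite -sum_out; apply: eq_bigr => t vt.
    by rewrite (U'R t) ?(RadjE t v) 1?adj_sym // -mulrA -natrM mulnb andbC.
  have /andP[e0 ez] := e_le v U vR.
  rewrite U'v //; move: (xin v) (xout v) (e v U) (z U) e0 ez => i o ev zv e0 ez.
  clear -e0 ez.
  by case: (lerP o i) => io /=; nra.
rewrite /BCR_cost.
apply: (le_trans (ler_sum _ (fun U _ => k_cut U))).
rewrite exchange_big /=; apply: ler_sum => a aE.
by rewrite -mulr_suml ler_wpM2r ?x_ge0 ?k_le.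
Qed.

Lemma darcs_subset {V : finType} (E : {set {set V}}) (R : {set V})
    (K : rooted_subgraph V) :
  K \in dir_full_components E R -> darcs K \subset arcs E.
Proof.
rewrite inE => /asboolP[[[_ /fintype.subsetP FE _ _ _] _ _] _ _].
apply/fintype.subsetP => -[u v]; rewrite inE => /asboolP[p [/= /andP[uv _] _ _]].
by rewrite inE; exact: FE.
Qed.

(** Suffixes of a simple path are simple, so each of its edges is oriented along the path; the first
    one leaving [U] is the required arc. *)
Lemma orient_crossing {V : finType} (F : {set {set V}}) (U : {set V}) s p :
    path (adj F) s p -> uniq (s :: p) -> s \in U -> last s p \notin U ->
  exists2 a, a \in orient F (last s p) & (a.1 \in U) && (a.2 \notin U).
Proof.
elim: p s => [s _ _ /= -> //|v p IH s].
move=> svp usvp sU tU; case: (boolP (v \in U)) => vU; last first.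
  by exists (s, v); rewrite /= ?sU //= inE; apply/asboolP; exists p.
move: svp usvp => /= /andP[_ vp] /andP[_ uvp].
exact: IH vp uvp vU tU.
Qed.

Lemma Delta_plus_crossing {V : finType} (E : {set {set V}}) (R U : {set V})
    (K : rooted_subgraph V) :
  K \in Delta_plus E R (U :&: R)%SET ->
  exists2 a, a \in darcs K & a \in delta_plus E U.
Proof.
rewrite inE => /and3P[dK tU /existsP[s /andP[]]].
rewrite finset.in_setD1 !finset.in_setI => /and3P[_ sK sR] /andP[sU _].
have /fintype.subsetP KE := darcs_subset E R K dK.
move: dK; rewrite inE => /asboolP[[[_ _ _ conn _] _ _] tK tR].
have /connectP[p0 p0P] := conn s (sink K) sK tK.
case/shortenP: p0P => p sp usp _ lastp.
have [|a aK aU] := orient_crossing (dedges K) U s p sp usp sU.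
  by rewrite -lastp; move: tU; rewrite finset.in_setI tR andbT.
have {}aK : a \in darcs K by rewrite /darcs lastp.
by exists a => //; rewrite inE KE.
Qed.

(** If the sink lies in [A] or [B], the union contributes nothing, and the intersection can
    contribute only through a set that avoids the sink. Otherwise a source in the union lies in one
    of the sets, and one in the intersection lies in both. *)
Lemma Delta_plus_submodular {RR : realType} {V : finType} (E : {set {set V}})
    (R A B : {set V}) (K : rooted_subgraph V) :
  ((K \in Delta_plus E R (A :&: B)%SET)%:R +
   (K \in Delta_plus E R (A :|: B)%SET)%:R : RR) <=
  (K \in Delta_plus E R A)%:R + (K \in Delta_plus E R B)%:R.
Proof.
pose hit (U : {set V}) := [exists s in sources R K, s \in U].
have DeltaE U : (K \in Delta_plus E R U) =
    [&& K \in dir_full_components E R, sink K \notin U & hit U].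
  by rewrite finset.in_set.
rewrite -!natrD ler_nat !DeltaE finset.in_setI finset.in_setU.
case: (K \in dir_full_components E R) => //=.
have hitS (U W : {set V}) : U \subset W -> hit U ==> hit W.
  move=> /fintype.subsetP UW; apply/implyP => /existsP[s /andP[sK sU]].
  by apply/existsP; exists s; rewrite sK UW.
have hitU : hit (A :|: B)%SET ==> hit A || hit B.
  apply/implyP => /existsP[s /andP[sK]]; rewrite inE => /orP[sU|sU].
    by apply/orP; left; apply/existsP; exists s; rewrite sK.
  by apply/orP; right; apply/existsP; exists s; rewrite sK.
move: (hitS _ _ (finset.subsetIl A B)) (hitS _ _ (finset.subsetIr A B)) hitU.
by case: (sink K \in A); case: (sink K \in B); case: (hit (A :&: B)%SET);
  case: (hit (A :|: B)%SET); case: (hit A); case: (hit B).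
Qed.

Lemma DCR_to_BCR {RR : realType} {V : finType} (E : {set {set V}})
    (R : {set V}) (r : V) (c : V * V -> RR) (f : {set V} -> RR)
    (y : rooted_subgraph V -> RR) :
  DCR_feasible E R r f y ->
  exists2 x, BCR_feasible E R r f x & BCR_cost E c x = DCR_cost E R c y.
Proof.
case=> y_ge0 y_cut.
exists (fun a => \sum_(K in dir_full_components E R | a \in darcs K) y K).
  split=> [a _|U /andP[U0 rU]].
    by apply: sumr_ge0 => K /andP[dK _]; exact: y_ge0.
  apply: (@le_trans _ _ (\sum_(K in Delta_plus E R (U :&: R)%SET) y K)).
    apply: y_cut => //; apply/fintype.subsetP => u; rewrite !inE => /andP[uU ->].
    by rewrite andbT; apply: contraNneq rU => <-.
  rewrite (exchange_big_dep (mem (dir_full_components E R))) /=; last first.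
    by move=> a K _ /andP[].
  rewrite (eq_bigl (fun K => (K \in dir_full_components E R) &&
    (K \in Delta_plus E R (U :&: R)%SET))); last first.
    by move=> K; rewrite andb_idl // inE => /andP[].
  rewrite big_mkcondr; apply: ler_sum => K dK /=.
  (* Some arc of [K] crosses [U], so [y K] occurs at least once in the inner sum. *)
  have yK := y_ge0 K dK.
  case: ifP => [/Delta_plus_crossing[a aK aU]|_]; last exact: sumr_ge0.
  rewrite (bigD1 a) /=; last by rewrite aU dK.
  by rewrite lerDl sumr_ge0.
rewrite /BCR_cost /DCR_cost.
under eq_bigr => a _ do rewrite mulr_sumr.
rewrite (exchange_big_dep (mem (dir_full_components E R))) /=; last first.
  by move=> a K _ /andP[].
apply: eq_bigr => K dK; rewrite mulr_suml; apply: eq_bigl => a.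
rewrite dK andb_idl //.
exact: (fintype.subsetP (darcs_subset E R K dK)).
Qed.

Lemma BCR_to_DCR {RR : realType} {V : finType} (E : {set {set V}})
    (R : {set V}) (r : V) (c : V * V -> RR) (f : {set V} -> RR)
    (x : V * V -> RR) :
    simple_graph E -> r \in R -> quasi_bipartite E R ->
    (forall a, a \in arcs E -> 0 <= c a) ->
    intersecting_supermodular R f -> BCR_feasible E R r f x ->
  exists2 y, DCR_feasible E R r f y & DCR_cost E R c y <= BCR_cost E c x.
Proof.
move=> hE hr hqb c_ge0 hf hx.
pose good (U : {set V}) := (U != finset.set0) && (U \subset (R :\ r)%SET).
(* Row [None] is the budget [BCR_cost E c x], row [Some U] the negated cut constraint of [U]. For
   sets that are not [good] both sides vanish, which leaves 0 <= 0. *)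
pose A (i : option {set V}) K : RR :=
  if i is Some U then - (good U && (K \in Delta_plus E R U))%:R
  else (K \in dir_full_components E R)%:R * comp_cost c K.
pose b (i : option {set V}) : RR :=
  if i is Some U then - ((good U)%:R * f U) else BCR_cost E c x.
case: (farkas A b) => [[y [y_ge0 yb]]|[w [w_ge0 wA wb]]].
  exists y; last first.
    apply: le_trans (yb None); rewrite /DCR_cost big_mkcond /=.
    by apply: ler_sum => K _; case: ifP; rewrite ?mul1r ?mul0r.
  split=> // U U0 UR; have := yb (Some U).
  rewrite /= /good U0 UR mul1r /= -lerN2 opprK -sumrN; congr (_ <= _).
  rewrite [RHS]big_mkcond; apply: eq_bigr => K _.
  by case: ifP; rewrite mulNr opprK ?mul1r ?mul0r.
exfalso.
(* Uncrossing must increase neither the load of any component nor the negated dual objective; the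
   latter is where supermodularity of [f] enters. *)
pose g (i : option (rooted_subgraph V)) U : RR :=
  if i is Some K then (K \in Delta_plus E R U)%:R else - f U.
have good_sub U : good U -> U \subset R.
  by move=> /andP[_ UR]; apply: (fintype.subset_trans UR); exact: finset.subD1set.
have [|i B C gB gC BC||z [z_ge0 z_good z_lam z_le]] :=
  uncrossing good g (w \o some).
- move=> B C /andP[B0 BR] /andP[C0 CR] BC; split; apply/andP; split=> //.
  + exact: fintype.subset_trans (finset.subsetIl _ _) BR.
  + by rewrite finset.setU_eq0 negb_and B0.
  + by rewrite finset.subUset BR.
- case: i => [K|] /=; first exact: Delta_plus_submodular.
  by have := hf B C (good_sub B gB) (good_sub C gC) BC; lra.
- by move=> U; exact: w_ge0.
(* Scaling the costs by the multiplier [l], rather than dividing the weights by it, also covers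
   [l = 0]. *)
pose l := w None.
have z_packing K : K \in dir_full_components E R ->
    \sum_(U | K \in Delta_plus E R U) z U <= comp_cost (fun a => l * c a) K.
  move=> dK; have := wA K; rewrite sum_option /= dK mul1r -/l.
  rewrite /comp_cost -mulr_sumr => wK.
  have -> : \sum_(U | K \in Delta_plus E R U) z U =
      \sum_(U | good U) (K \in Delta_plus E R U)%:R * z U.
    rewrite big_mkcond [RHS]big_mkcond; apply: eq_bigr => U _.
    have [->|/z_good ->] := eqVneq (z U) 0; first by rewrite mulr0 !if_same.
    by case: ifP; rewrite ?mul1r ?mul0r.
  apply: (le_trans (z_le (Some K))); rewrite -subr_ge0.
  apply: (le_trans wK); rewrite lerD2l [X in _ <= - X]big_mkcond -sumrN.
  apply: ler_sum => U _ /=.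
  by case: (good U); rewrite /= ?mulrN ?oppr0 ?mulr0 // mulrC.
have lc_ge0 a : a \in arcs E -> 0 <= l * c a.
  by move=> /c_ge0; apply: mulr_ge0; exact: w_ge0.
have := laminar_dual_bound E R r (fun a => l * c a) f z x hE hr hqb lc_ge0 hx
  z_ge0 z_lam (fun U zU => andP (z_good U zU)) z_packing.
have -> : BCR_cost E (fun a => l * c a) x = l * BCR_cost E c x.
  by rewrite mulr_sumr; apply: eq_bigr => a _; rewrite mulrA.
have := z_le None; rewrite /= => z_f.
have -> : \sum_U z U * f U = - \sum_(U | good U) - f U * z U.
  rewrite -sumrN [RHS]big_mkcond; apply: eq_bigr => U _.
  have [->|/z_good ->] := eqVneq (z U) 0; first by rewrite mulr0 mul0r oppr0 if_same.
  by rewrite mulNr opprK mulrC.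
move: wb; rewrite sum_option /= -/l.
have -> : \sum_U w (Some U) * - ((good U)%:R * f U) =
    \sum_(U | good U) - f U * w (Some U).
  rewrite [RHS]big_mkcond; apply: eq_bigr => U _.
  by case: ifP => _; rewrite ?mul1r ?mul0r ?oppr0 ?mulr0 // mulrC.
by move: z_f => /=; lra.
Qed.

Theorem theorem2 (RR : realType) (V : finType) (E : {set {set V}})
    (R : {set V}) (r : V) (c : V * V -> RR) (f : {set V} -> RR)
    (hE : simple_graph E) (hr : r \in R) (hqb : quasi_bipartite E R)
    (hc : forall a, a \in arcs E -> 0 <= c a)
    (hf : intersecting_supermodular R f) :
  BCR_opt E R r c f = DCR_opt E R r c f.
Proof.
apply/le_anti/andP; split.
  apply: le_ereal_inf_tmp => _ [y hy <-].
  have [x hx <-] := DCR_to_BCR E R r c f y hy.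
  by apply: ereal_inf_lbound; exists x.
apply: le_ereal_inf_tmp => _ [x hx <-].
have [y hy yx] := BCR_to_DCR E R r c f x hE hr hqb hc hf hx.
by apply: ge_ereal_inf; exists (DCR_cost E R c y)%:E; [exists y | rewrite lee_fin].
Qed.
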